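(* Let $r\geq 2$, $p\in[1,r-1]$ and $\nu\in[0,r-p]$ be integers. Consider the set $\mathcal{GP}(r,\nu,p)$ and the set $\overline{\mathbb{L}}(H)$, with $H=\mathrm{diag}\{E_{\nu,r-p},\,I_p\}$, of all the corresponding $r\times r$ state space matrices. This set of state space matrices forms a closed invertible cone of realizations of functions with at most $\nu$ poles in $\mathbb{C}_-$ and at most $r-p-\nu$ poles in $\mathbb{C}_+$. Moreover, it is a maximal convex realization set with this property, in the following sense: each matrix in the set has at most $\nu$ eigenvalues in $\mathbb{C}_-$ and at most $r-\nu$ eigenvalues in $\mathbb{C}_+$, and if $\tilde L$ is an $r\times r$ realization matrix of a $p\times p$-valued rational function $\tilde\psi\notin\mathcal{GP}(r,\nu,p)$, then there exists $L$ in the set such that $L+\tilde L$ has $\nu+1$ eigenvalues in $\mathbb{C}_-$ or $r-\nu+1$ eigenvalues in $\mathbb{C}_+$.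
   Context: $\mathbb{C}_+$ and $\mathbb{C}_-$ are the open right and left half planes; $\overline{\mathbb{P}}_k$ is the set of $k\times k$ Hermitian positive semidefinite complex matrices. For a Hermitian nonsingular $r\times r$ matrix $H$, $\overline{\mathbb{L}}(H):=\{L\in\mathbb{C}^{r\times r}: HL+L^*H\in\overline{\mathbb{P}}_r\}$. For integers $0\le\nu\le l$, $E_{\nu,l}:=\mathrm{diag}\{-I_\nu,\,I_{l-\nu}\}$. An $r\times r$ matrix partitioned as $L=\begin{pmatrix}A&B\\ C&D\end{pmatrix}$, with $A$ of size $(r-p)\times(r-p)$ and $D$ of size $p\times p$, is a realization (state space, or system) matrix of the $p\times p$-valued rational function $C(sI_{r-p}-A)^{-1}B+D$. $\mathcal{GP}(r,\nu,p)$ is the set of all $p\times p$-valued rational functions $C(sI_{r-p}-A)^{-1}B+D$ whose matrix $L=\begin{pmatrix}A&B\\ C&D\end{pmatrix}$ lies in $\overline{\mathbb{L}}(H)$, $H=\mathrm{diag}\{E_{\nu,r-p},I_p\}$. Realizations need not be minimal. A set of square matrices is a convex invertible cone if it is closed under multiplication by positive scalars, summation and inversion (it may contain singular elements, provided that the inverse of each of its nonsingular elements belongs to it); an invertible cone is a cone closed under inversion in this sense. *)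

(* Defs.v *)
From HB Require Import structures.
From mathcomp Require Import all_boot all_order all_algebra.
From mathcomp Require Import all_classical all_reals all_analysis.
From mathcomp.real_closed Require Import complex.

Set Implicit Arguments.
Unset Strict Implicit.
Unset Printing Implicit Defensive.

Import Order.TTheory GRing.Theory Num.Theory.
Import numFieldNormedType.Exports.
Local Open Scope ring_scope.
Local Open Scope sesquilinear_scope.
Local Open Scope classical_set_scope.

(* The bundled type makes the norm topology of any [numClosedFieldType]         *)
(* available on the complex numbers: inference does not find it on bare [R[i]]. *)
Definition complexC (R : realType) : numClosedFieldType := R[i].

Section MatrixSets.
Variable C : numClosedFieldType.

Definition open_left : pred C := fun z => 'Re z < 0.
Definition open_right : pred C := fun z => 0 < 'Re z.

(* In the partial order of [C], [0 <= z] says that [z] is real and nonnegative. *)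
Definition psd n : set 'M[C]_n :=
  [set P | P \is hermsymmx /\
           forall x : 'cV[C]_n, 0 <= (x ^t* *m P *m x) 0 0].

Definition Lbar n (H : 'M[C]_n) : set 'M[C]_n :=
  [set L | psd (H *m L + L ^t* *m H)].

Definition Emx nu l : 'M[C]_l :=
  diag_mx (\row_(i < l) (if (i < nu)%N then -1 else 1)).

Definition Hmx nu n p : 'M[C]_(n + p) := block_mx (Emx nu n) 0 0 1%:M.

Definition convex_invertible_cone n (S : set 'M[C]_n) : Prop :=
  [/\ forall (a : C) L, 0 < a -> S L -> S (a *: L),
      forall L M, S L -> S M -> S (L + M)
    & forall L, S L -> L \in unitmx -> S (invmx L)].

End MatrixSets.

Section Spectra.
Variable C : closedFieldType.

(* The roots of [q], repeated according to their multiplicity (for [q != 0]). *)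
Definition root_seq (q : {poly C}) : seq C := sval (closed_field_poly_normal q).

Definition num_eigenvalues (U : pred C) n (A : 'M[C]_n) : nat :=
  count U (root_seq (char_poly A)).

End Spectra.

Section RationalFunctions.
Variable C : closedFieldType.

Definition ratfun := {fraction {poly C}}.

Definition scalar_ratfun (a : C) : ratfun := tofrac a%:P.

Definition transfer n p (L : 'M[C]_(n + p)) : 'M[ratfun]_p :=
  let A := map_mx scalar_ratfun (ulsubmx L) in
  let B := map_mx scalar_ratfun (ursubmx L) in
  let K := map_mx scalar_ratfun (dlsubmx L) in
  let D := map_mx scalar_ratfun (drsubmx L) in
  K *m invmx ((tofrac 'X)%:M - A) *m B + D.

(* The denominator in lowest terms. *)
Definition denominator (f : ratfun) : {poly C} :=
  let: (u, v) := frac (repr f) in v %/ gcdp u v.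

Definition lcmp (u v : {poly C}) : {poly C} := (u * v) %/ gcdp u v.

(* The McMillan pole polynomial (up to a nonzero scalar): the least common      *)
(* denominator of all the minors. Index maps that are not increasing only       *)
(* contribute, up to sign, another minor or 0.                                  *)
Definition pole_poly p (F : 'M[ratfun]_p) : {poly C} :=
  \big[lcmp/1]_(k < p.+1)
    \big[lcmp/1]_(f : {ffun 'I_k -> 'I_p})
      \big[lcmp/1]_(g : {ffun 'I_k -> 'I_p})
        denominator (\det (mxsub f g F)).

Definition num_poles (U : pred C) p (F : 'M[ratfun]_p) : nat :=
  count U (root_seq (pole_poly F)).

End RationalFunctions.

Definition GP (C : numClosedFieldType) (r nu p : nat) : set 'M[ratfun C]_p :=
  [set psi | exists2 L : 'M[C]_((r - p) + p),
               Lbar (Hmx C nu (r - p) p) L & psi = transfer L].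

(* Main.v *)
(* If [L X = X T] with [T] upper triangular and spectrum in the open left half  *)
(* plane, then [G := X^* H X] satisfies [G T + T^* G >= 0], which forces        *)
(* [G <= 0]: split off the first vector by a Schur complement and induct. Hence *)
(* [H] is nonpositive on the sum of the generalized eigenspaces of [L] for the  *)
(* open left half plane, and by inertia its dimension is at most [nu]; the      *)
(* right half plane is symmetric. The same bound holds for the block [A] of     *)
(* [L], and every minor of the transfer function times the characteristic       *)
(* polynomial of [A] is a polynomial, so the pole polynomial divides the latter.*)
(*                                                                              *)
(* For maximality only the fact that [M := Lt] lies outside the cone matters.   *)
(* Choose [x] with [x^* (H M + M^* H) x < 0] and [x^* H x <> 0], and an         *)
(* [H]-unitary reflection [R] sending some basis vector [e_j] to a multiple of  *)
(* [x]. Adding to [M] an element of the cone one can reach [R H Z R] for any    *)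
(* [Z] whose Hermitian part dominates that of [R^* H M R]; a triangular [Z]     *)
(* works, with a negative [j]-th diagonal entry and positive other ones. The    *)
(* spectrum of [H Z] is that of [H] up to positive factors, except that the     *)
(* [j]-th eigenvalue has changed sign.                                          *)
Require Import Defs.
From mathcomp Require Import all_boot all_order all_algebra.
From mathcomp Require Import all_classical all_reals all_analysis.
From mathcomp.real_closed Require Import complex.
From mathcomp Require Import ring.
Set Implicit Arguments.
Unset Strict Implicit.
Unset Printing Implicit Defensive.
Import Order.TTheory GRing.Theory Num.Theory.
Import numFieldNormedType.Exports.
Local Open Scope ring_scope.
Local Open Scope sesquilinear_scope.
Local Open Scope classical_set_scope.

(** * Roots and eigenvalues *)

Section Roots.
Variable C : closedFieldType.
Implicit Types (p q : {poly C}) (U : pred C).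

Lemma root_seq_eq p : p = lead_coef p *: \prod_(z <- root_seq p) ('X - z%:P).
Proof. exact: svalP (closed_field_poly_normal p). Qed.

Lemma root_seq_scale_prod (a : C) (s : seq C) : a != 0 ->
  perm_eq (root_seq (a *: \prod_(z <- s) ('X - z%:P))) s.
Proof.
move=> a0; apply: prod_XsubC_eq; apply/(scalerI a0).
by rewrite [RHS]root_seq_eq lead_coefZ (eqP (monic_prod_XsubC s predT id)) mulr1.
Qed.

Lemma root_seq_prod (s : seq C) :
  perm_eq (root_seq (\prod_(z <- s) ('X - z%:P))) s.
Proof. by have := root_seq_scale_prod s (oner_neq0 C); rewrite scale1r. Qed.

Lemma root_seqM p q : p != 0 -> q != 0 ->
  perm_eq (root_seq (p * q)) (root_seq p ++ root_seq q).
Proof.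
rewrite -!(lead_coef_eq0 p) -(lead_coef_eq0 q) => p0 q0.
rewrite [p in root_seq (p * _)]root_seq_eq [q in root_seq (_ * q)]root_seq_eq.
rewrite -scalerAl -scalerAr scalerA -big_cat /=.
exact: root_seq_scale_prod (mulf_neq0 p0 q0).
Qed.

Lemma count_root_seq_dvdp U p q : q != 0 -> p %| q ->
  (count U (root_seq p) <= count U (root_seq q))%N.
Proof.
move=> q0 /dvdpP [w qE]; have := q0; rewrite qE mulf_eq0 negb_or => /andP[w0 p0].
by rewrite (permP (root_seqM w0 p0)) count_cat leq_addl.
Qed.

Lemma num_eigenvalues_trig U n (A : 'M[C]_n) : is_trig_mx A ->
  num_eigenvalues U A = #|[pred i | U (A i i)]|.
Proof.
move=> /char_poly_trig pA; rewrite /num_eigenvalues pA.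
rewrite -(big_map (fun i => A i i) predT (fun z => 'X - z%:P)).
rewrite (permP (root_seq_prod _)) count_map cardE /enum_mem size_filter.
by rewrite /index_enum unlock.
Qed.

Lemma char_poly_intertwine n (P A B : 'M[C]_n) :
  P \in unitmx -> P *m A = B *m P -> char_poly A = char_poly B.
Proof.
rewrite unitmxE unitfE => P0 PA.
have c0 : \det (map_mx polyC P) != 0 by rewrite det_map_mx polyC_eq0.
apply: (mulfI c0); rewrite [RHS]mulrC /char_poly -!det_mulmx /char_poly_mx.
by rewrite mulmxBr mulmxBl scalar_mxC -!map_mxM PA.
Qed.
End Roots.

(** * Poles of the transfer function *)

Section Poles.
Variable C : closedFieldType.
Implicit Types (u v c w : {poly C}).

Lemma ratfun_repr (f : ratfun C) :
  f * tofrac (frac (repr f)).2 = tofrac (frac (repr f)).1.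
Proof.
rewrite -[X in X * _]reprK; set x := repr f.
have d0 : (frac x).2 != 0 by apply: denom_ratioP.
unlock FracField.tofrac; rewrite -[LHS]FracField.pi_mul.
apply/eqmodP; rewrite /= FracField.equivfE /FracField.mulf.
by rewrite !numden_Ratio ?oner_neq0 ?mulr1 // mulrC.
Qed.

Lemma denominator_dvdp (f : ratfun C) c w : c != 0 ->
  f * tofrac c = tofrac w -> denominator f %| c.
Proof.
move=> c0 fc; rewrite /denominator.
have := ratfun_repr f; have := denom_ratioP (repr f).
case: (frac (repr f)) => u v /= v0 fv.
have uc : u * c = w * v.
  by apply/eqP; rewrite -tofrac_eq !tofracM -fv -fc mulrAC.
have g0 : gcdp u v != 0 by rewrite gcdp_eq0 negb_and v0 orbT.
have cop : coprimep (v %/ gcdp u v) (u %/ gcdp u v).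
  by rewrite coprimep_sym coprimep_div_gcd // v0 orbT.
rewrite -(Gauss_dvdpr _ cop); apply/dvdpP; exists w; apply: (mulfI g0).
by rewrite mulrCA mulrA divpK ?dvdp_gcdl // uc mulrCA divpKC // dvdp_gcdr.
Qed.

Lemma lcmp_dvdp u v c : u %| c -> v %| c -> lcmp u v %| c.
Proof.
have [->|c0] := eqVneq c 0; first by rewrite dvdp0.
move=> uc vc.
have u0 : u != 0 by apply: contraNneq c0 => u0; rewrite u0 dvd0p in uc.
have v0 : v != 0 by apply: contraNneq c0 => v0; rewrite v0 dvd0p in vc.
have g0 : gcdp u v != 0 by rewrite gcdp_eq0 negb_and u0.
rewrite /lcmp -(dvdp_mul2r _ _ g0) divpK; last exact/dvdp_mulr/dvdp_gcdl.
have /eqp_dvdr-> : c * gcdp u v %= gcdp (c * u) (c * v) by rewrite mulp_gcdr.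
by rewrite dvdp_gcd [u * v]mulrC dvdp_mul2r // vc mulrC dvdp_mul2r // uc.
Qed.

Lemma biglcmp_dvdp (I : finType) (F : I -> {poly C}) c :
  (forall i, F i %| c) -> \big[(@lcmp C)/1]_i F i %| c.
Proof.
by move=> Fc; elim/big_ind: _ => // [|u v]; [exact: dvd1p | exact: lcmp_dvdp].
Qed.

Lemma det_schur (F : fieldType) n k (A : 'M[F]_n) (B : 'M[F]_(n, k))
    (K : 'M[F]_(k, n)) (D : 'M[F]_k) :
  A \in unitmx ->
  \det (block_mx A B K D) = \det A * \det (D - K *m invmx A *m B).
Proof.
move=> Au.
have -> : block_mx A B K D = block_mx A 0 K 1%:M
    *m block_mx 1%:M (invmx A *m B) 0 (D - K *m invmx A *m B).
  rewrite mulmx_block !mulmx1 !mul0mx !mulmx0 !mul1mx !addr0 mulKVmx //.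
  by rewrite mulmxA addrC subrK.
by rewrite det_mulmx det_lblock det_ublock !det1 mulr1 mul1r.
Qed.

Lemma minor_transfer n p k (L : 'M[C]_(n + p)) (f g : 'I_k -> 'I_p) :
  exists w : {poly C},
    \det (mxsub f g (transfer L)) * tofrac (char_poly (ulsubmx L)) = tofrac w.
Proof.
set A := ulsubmx L; set B := colsub g (ursubmx L).
set K := rowsub f (dlsubmx L); set D := mxsub f g (drsubmx L).
exists (\det (block_mx (char_poly_mx A) (map_mx polyC B)
                       (- map_mx polyC K) (map_mx polyC D))).
have char_mxE : map_mx (@FracField.tofrac _) (char_poly_mx A)
    = (tofrac 'X)%:M - map_mx (@scalar_ratfun C) A.
  rewrite /char_poly_mx map_mxB map_scalar_mx -map_mx_comp.
  by congr (_ - _).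
rewrite -!det_map_mx map_block_mx det_schur; last first.
  rewrite unitmxE unitfE det_map_mx tofrac_eq0 monic_neq0 //.
  exact: char_poly_monic.
rewrite mulrC; congr (_ * \det _); rewrite char_mxE map_mxN mulNmx mulNmx opprK addrC.
apply/matrixP => i j; rewrite !mxE; congr (_ + _).
apply: eq_bigr => l _; rewrite !mxE; congr (_ * _).
by apply: eq_bigr => m _; rewrite !mxE.
Qed.

Lemma pole_poly_dvdp n p (L : 'M[C]_(n + p)) :
  pole_poly (transfer L) %| char_poly (ulsubmx L).
Proof.
apply: biglcmp_dvdp => k; apply: biglcmp_dvdp => f; apply: biglcmp_dvdp => g.
have [w wE] := minor_transfer L f g.
by apply: denominator_dvdp wE; rewrite monic_neq0 // char_poly_monic.
Qed.

Lemma num_poles_le (U : pred C) n p (L : 'M[C]_(n + p)) :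
  (num_poles U (transfer L) <= num_eigenvalues U (ulsubmx L))%N.
Proof.
apply: count_root_seq_dvdp (pole_poly_dvdp L).
by rewrite monic_neq0 // char_poly_monic.
Qed.
End Poles.

(** * Hermitian forms *)

Section HermitianForms.
Variable C : numClosedFieldType.

Definition qform n (P : 'M[C]_n) (x : 'cV_n) : C := (x ^t* *m P *m x) 0 0.

Definition lyap n (H L : 'M[C]_n) : 'M[C]_n := H *m L + L ^t* *m H.

Lemma adjmxM m n k (A : 'M[C]_(m, n)) (B : 'M[C]_(n, k)) :
  (A *m B) ^t* = B ^t* *m A ^t*.
Proof. by rewrite trmx_mul map_mxM. Qed.

Lemma adjmxD m n (A B : 'M[C]_(m, n)) : (A + B) ^t* = A ^t* + B ^t*.
Proof. by rewrite linearD map_mxD. Qed.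

Lemma adjmxN m n (A : 'M[C]_(m, n)) : (- A) ^t* = - A ^t*.
Proof. by rewrite linearN map_mxN. Qed.

Lemma adjmxZ m n (a : C) (A : 'M[C]_(m, n)) : (a *: A) ^t* = a^* *: A ^t*.
Proof. by rewrite linearZ map_mxZ. Qed.

Lemma adjmx_scalar n (a : C) : (a%:M : 'M[C]_n) ^t* = (a^*)%:M.
Proof. by rewrite tr_scalar_mx map_scalar_mx. Qed.

Lemma adj_col_mx m1 m2 n (A : 'M[C]_(m1, n)) (B : 'M[C]_(m2, n)) :
  (col_mx A B) ^t* = row_mx (A ^t*) (B ^t*).
Proof. by rewrite tr_col_mx map_row_mx. Qed.

Lemma adj_block_mx m1 m2 n1 n2 (A : 'M[C]_(m1, n1)) (B : 'M[C]_(m1, n2))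
    (K : 'M[C]_(m2, n1)) (D : 'M[C]_(m2, n2)) :
  (block_mx A B K D) ^t* = block_mx (A ^t*) (K ^t*) (B ^t*) (D ^t*).
Proof. by rewrite tr_block_mx map_block_mx. Qed.

Lemma adjmx11 (A : 'M[C]_1) : A ^t* 0 0 = (A 0 0)^*.
Proof. by rewrite !mxE. Qed.

Lemma hermsymmxE n (P : 'M[C]_n) : (P \is hermsymmx) = (P ^t* == P).
Proof. by rewrite sesquiE expr0 scale1r eq_sym. Qed.

Lemma adj_sandwich n k (X : 'M[C]_(n, k)) (P : 'M[C]_n) :
  P ^t* = P -> (X ^t* *m P *m X) ^t* = X ^t* *m P *m X.
Proof. by move=> Ph; rewrite !adjmxM trmxCK Ph mulmxA. Qed.

Lemma qform_real n (P : 'M[C]_n) x : P ^t* = P -> (qform P x)^* = qform P x.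
Proof. by move=> Ph; rewrite -adjmx11 adj_sandwich. Qed.

Lemma qformD n (P Q : 'M[C]_n) x : qform (P + Q) x = qform P x + qform Q x.
Proof. by rewrite /qform mulmxDr mulmxDl mxE. Qed.

Lemma qformN n (P : 'M[C]_n) x : qform (- P) x = - qform P x.
Proof. by rewrite /qform mulmxN mulNmx mxE. Qed.

Lemma qformZ n a (P : 'M[C]_n) x : qform (a *: P) x = a * qform P x.
Proof. by rewrite /qform -scalemxAr -scalemxAl mxE. Qed.

Lemma qform_sandwich n k (X : 'M[C]_(n, k)) (P : 'M[C]_n) x :
  qform (X ^t* *m P *m X) x = qform P (X *m x).
Proof. by rewrite /qform adjmxM !mulmxA. Qed.

Lemma qform_diag n (d : 'rV[C]_n) x :
  qform (diag_mx d) x = \sum_i d 0 i * `|x i 0| ^+ 2.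
Proof.
rewrite /qform mul_mx_diag mxE; apply: eq_bigr => i _.
by rewrite !mxE normCK; ring.
Qed.

Lemma psdP n (P : 'M[C]_n) :
  psd P <-> P ^t* = P /\ (forall x, 0 <= qform P x).
Proof. split=> -[Ph P0]; split=> //; first by apply/eqP; rewrite -hermsymmxE.
by rewrite hermsymmxE Ph. Qed.

Lemma psd_sandwich n k (X : 'M[C]_(n, k)) (P : 'M[C]_n) :
  psd P -> psd (X ^t* *m P *m X).
Proof.
move=> /psdP[Ph P0]; apply/psdP; split; first exact: adj_sandwich.
by move=> x; rewrite qform_sandwich.
Qed.

Lemma psd_add n (P Q : 'M[C]_n) : psd P -> psd Q -> psd (P + Q).
Proof.
move=> /psdP[Ph P0] /psdP[Qh Q0]; apply/psdP; rewrite adjmxD Ph Qh; split=> // x.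
by rewrite qformD addr_ge0.
Qed.

Lemma psd_scale n (a : C) (P : 'M[C]_n) : 0 <= a -> psd P -> psd (a *: P).
Proof.
move=> a0 /psdP[Ph P0]; apply/psdP.
rewrite adjmxZ Ph (CrealP (ger0_real a0)); split=> // x.
by rewrite qformZ mulr_ge0.
Qed.

Lemma adj_lyap n (H L : 'M[C]_n) : H ^t* = H -> (lyap H L) ^t* = lyap H L.
Proof. by move=> Hh; rewrite adjmxD !adjmxM trmxCK Hh addrC. Qed.

Lemma lyap_intertwine n k (H L : 'M[C]_n) (X : 'M[C]_(n, k)) (T : 'M[C]_k) :
  L *m X = X *m T -> X ^t* *m lyap H L *m X = lyap (X ^t* *m H *m X) T.
Proof.
move=> LX; rewrite mulmxDr mulmxDl; congr (_ + _).
  by rewrite -!mulmxA LX.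
by rewrite !mulmxA -adjmxM LX adjmxM.
Qed.

Lemma LbarE n (H L : 'M[C]_n) : Lbar H L = psd (lyap H L).
Proof. by []. Qed.

Lemma norm_cvec_gt0 n (v : 'cV[C]_n) : v != 0 -> 0 < (v ^t* *m v) 0 0.
Proof.
have -> : (v ^t* *m v) 0 0 = \sum_i `|v i 0| ^+ 2.
  by rewrite mxE; apply: eq_bigr => i _; rewrite !mxE normCK mulrC.
move=> v0; rewrite lt_def sumr_ge0 ?andbT; last by move=> i _; rewrite exprn_ge0.
apply: contra v0; rewrite psumr_eq0 => [/allP vi|i _]; last by rewrite exprn_ge0.
apply/eqP/colP => i; have := vi i (mem_index_enum i).
by rewrite /= sqrf_eq0 normr_eq0 mxE => /eqP.
Qed.

Lemma psd_qform_eq0 n (P : 'M[C]_n) u : psd P -> qform P u = 0 -> P *m u = 0.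
Proof.
move=> /psdP[Ph P0] Pu; set v := P *m u; apply/eqP/negPn/negP => v0.
have N0 := norm_cvec_gt0 v0; set N := (v ^t* *m v) 0 0 in N0.
have M0 := P0 v; set M := qform P v in M0.
pose s := N / (M + 1).
have M1 : 0 < M + 1 by rewrite ltr_wpDl.
have s0 : 0 < s by rewrite divr_gt0.
have sR : s^* = s by apply/CrealP/ger0_real/ltW.
have vPu : v ^t* *m P *m u = v ^t* *m v by rewrite -mulmxA.
have uPv : u ^t* *m P *m v = v ^t* *m v by rewrite /v adjmxM Ph.
have := P0 (u - s *: v).
have -> : qform P (u - s *: v) = s * (s * M - 2 * N).
  rewrite /qform adjmxD adjmxN adjmxZ sR !mulmxDl !mulmxDr !mulNmx !mulmxN opprK.
  rewrite -!scalemxAl -!scalemxAr uPv vPu.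
  rewrite /M /N; move: Pu; rewrite /qform.
  move: (u ^t* *m P *m u) (v ^t* *m P *m v) (v ^t* *m v) => a b c a0.
  by rewrite !mxE a0; ring.
rewrite pmulr_rge0 // subr_ge0 => h.
have : s * M < N.
  rewrite /s mulrAC ltr_pdivrMr // ltr_pM2l //.
  by rewrite ltrDl.
by move=> /(le_lt_trans h); rewrite mulr_natl mulr2n gtrDl (lt_gtF N0).
Qed.
End HermitianForms.

Section InvariantSubspace.
Variable C : closedFieldType.

Lemma unitmx_with_row n (w : 'rV[C]_(1 + n)) : w != 0 ->
  exists2 P : 'M[C]_(1 + n), P \in unitmx & row_mx 1%:M 0 *m P = w.
Proof.
move=> w0; pose e : 'rV[C]_(1 + n) := row_mx 1%:M 0.
have ew : e *m col_mx w 0 = w by rewrite mul_row_col mul1mx mul0mx addr0.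
have rkE : \rank (e *m col_mx w 0) = \rank e.
  rewrite ew !rank_rV w0; case: eqP => // /eqP.
  by rewrite row_mx_eq0 oner_eq0.
by have [P Pu eP] := complete_unitmx rkE; exists P; rewrite // -eP.
Qed.

Lemma char_poly_lblock m n (A : 'M[C]_m) (B : 'M[C]_(n, m)) (D : 'M[C]_n) :
  char_poly (block_mx A 0 B D) = char_poly A * char_poly D.
Proof.
rewrite /char_poly /char_poly_mx scalar_mx_block map_block_mx opp_block_mx.
by rewrite add_block_mx raddf0 oppr0 addr0 det_lblock.
Qed.

Lemma char_poly_tr n (A : 'M[C]_n) : char_poly A^T = char_poly A.
Proof.
rewrite /char_poly -[RHS]det_tr; congr (\det _).
by rewrite /char_poly_mx linearB /= tr_scalar_mx map_trmx.
Qed.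

Lemma num_eigenvalues_tr U n (A : 'M[C]_n) :
  num_eigenvalues U A^T = num_eigenvalues U A.
Proof. by rewrite /num_eigenvalues char_poly_tr. Qed.

Lemma num_eigenvalues_gt0 (U : pred C) n (A : 'M[C]_n) :
  (0 < num_eigenvalues U A)%N ->
  exists2 a, U a & exists2 w : 'rV_n, w != 0 & w *m A = a *: w.
Proof.
rewrite -has_count => /hasP[a ar Ua]; exists a => //.
suff /eigenvalueP[w wA w0] : eigenvalue A a by exists w.
rewrite eigenvalue_root_char (root_seq_eq (char_poly A)).
by rewrite rootE hornerZ mulf_eq0 -rootE root_prod_XsubC ar orbT.
Qed.

Lemma eigenvalue_deflation n (A : 'M[C]_(1 + n)) a (w : 'rV_(1 + n)) :
  w != 0 -> w *m A = a *: w ->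
  exists (P : 'M[C]_(1 + n)) (b : 'cV[C]_n) (A' : 'M[C]_n),
    P \in unitmx /\ P *m A = block_mx a%:M 0 b A' *m P.
Proof.
move=> /unitmx_with_row [P Pu eP] wA; pose B := P *m A *m invmx P.
exists P, (dlsubmx B), (drsubmx B); split=> //.
have uB : usubmx B = row_mx a%:M 0.
  have -> : usubmx B = row_mx 1%:M 0 *m B.
    by rewrite -[in RHS](vsubmxK B) mul_row_col mul1mx mul0mx addr0.
  rewrite !mulmxA eP wA -eP -scalemxAl -mulmxA mulmxV // mulmx1.
  by rewrite scale_row_mx scaler0 scalemx1.
rewrite -[block_mx _ _ _ _]/(col_mx _ _) -uB.
have -> : row_mx (dlsubmx B) (drsubmx B) = dsubmx B by rewrite hsubmxK.
by rewrite vsubmxK mulmxKV.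
Qed.

Lemma invariant_subspace (U : pred C) n (A : 'M[C]_n) :
  exists k (T : 'M[C]_k) (Y : 'M[C]_(k, n)),
    [/\ k = num_eigenvalues U A, row_free Y, Y *m A = T *m Y,
        is_trig_mx T & forall i, U (T i i)].
Proof.
elim: n A => [|n IHn] A.
  exists 0%N, 0, 0; split=> [||||[]//].
  - rewrite num_eigenvalues_trig; first by rewrite eq_card0 // => -[].
    by apply/is_trig_mxP => -[].
  - by rewrite /row_free mxrank0.
  - by rewrite mul0mx mulmx0.
  - by apply/is_trig_mxP => -[].
have [E0|] := posnP (num_eigenvalues U A).
  exists 0%N, 0, 0; split=> [||||[]//]; first by rewrite E0.
  - by rewrite /row_free mxrank0.
  - by rewrite mul0mx mulmx0.
  - by apply/is_trig_mxP => -[].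
move=> /num_eigenvalues_gt0 [a Ua [w w0 wA]].
have [P [b [A' [Pu PA]]]] := eigenvalue_deflation w0 wA.
have [k [T [Y [kE Yfree YA Ttrig UT]]]] := IHn A'.
exists (1 + k)%N, (block_mx a%:M 0 (Y *m b) T), (block_mx 1%:M 0 0 Y *m P).
split.
- rewrite /num_eigenvalues (char_poly_intertwine Pu PA) char_poly_lblock.
  rewrite (permP (root_seqM _ _)) ?monic_neq0 ?char_poly_monic // count_cat.
  rewrite -![count _ _]/(num_eigenvalues _ _) -kE num_eigenvalues_trig.
    rewrite (eq_card (B := predT)) ?card_ord // => i.
    by rewrite !inE !mxE eqxx mulr1n.
  by apply/is_trig_mxP => i j; rewrite !ord1.
- rewrite /row_free mxrankMfree ?row_free_unit // rank_diag_block_mx mxrank1.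
  by rewrite (eqP Yfree).
- rewrite -mulmxA PA !mulmxA; congr (_ *m _); rewrite !mulmx_block.
  by rewrite !(mul1mx, mul0mx, mulmx0, mulmx1, addr0, add0r) YA.
- rewrite is_trig_block_mx // eqxx Ttrig andbT.
  by apply/is_trig_mxP => i j; rewrite !ord1.
- move=> i; case: (split_ordP i) => j ->.
    by rewrite block_mxEul ord1 mxE eqxx mulr1n.
  by rewrite block_mxEdr.
Qed.
End InvariantSubspace.

(** * Inertia bounds *)

Section Inertia.
Variable C : numClosedFieldType.

Lemma qformD_orthogonal n (G : 'M[C]_n) (a b : 'cV_n) :
  a ^t* *m G *m b = 0 -> b ^t* *m G *m a = 0 ->
  qform G (a + b) = qform G a + qform G b.
Proof.
move=> ab ba; rewrite /qform adjmxD !mulmxDl !mulmxDr ab ba addr0 add0r.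
by rewrite mxE.
Qed.

Lemma lyap_stable_npsd k (T G : 'M[C]_k) :
  is_trig_mx T^T -> (forall i, 'Re (T i i) < 0) ->
  G ^t* = G -> psd (lyap G T) -> psd (- G).
Proof.
elim: k T G => [|k IHk] T G Ttrig Tneg Gh psdW.
  apply/psdP; split; first by rewrite adjmxN Gh.
  by move=> x; rewrite /qform [x ^t*]thinmx0 !mul0mx mxE.
pose n := (1 + k)%N.
rewrite -[k.+1]/n in T G Ttrig Tneg Gh psdW *.
pose t := T 0 0; pose tau := ursubmx T; pose T' := drsubmx T.
have TE : T = block_mx t%:M tau 0 T'.
  move: Ttrig; rewrite -[T in T^T]submxK tr_block_mx is_trig_block_mx //.
  move=> /andP[/eqP/(congr1 trmx)]; rewrite trmxK trmx0 => dl0 _.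
  rewrite -[LHS]submxK dl0; congr block_mx.
  by rewrite [LHS]mx11_scalar !mxE !lshift0.
have T'trig : is_trig_mx T'^T.
  move: Ttrig; rewrite -[T in T^T]submxK tr_block_mx is_trig_block_mx //.
  by case/and3P.
have T'neg i : 'Re (T' i i) < 0 by rewrite !mxE.
pose E : 'cV[C]_n := col_mx 1%:M 0.
pose Z : 'M[C]_(n, k) := col_mx 0 1%:M.
pose g := G 0 0; pose gam : 'rV[C]_k := E ^t* *m G *m Z.
have gE : E ^t* *m G *m E = g%:M.
  rewrite [LHS]mx11_scalar; congr (_%:M).
  rewrite /E adj_col_mx -[in LHS](submxK G) mul_row_block mul_row_col.
  rewrite adjmx_scalar conjC1 trmx0 map_mx0 !mul1mx !mul0mx mulmx0 mulmx1 !addr0.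
  by rewrite !mxE lshift0.
have TEE : T *m E = t *: E.
  rewrite TE mul_block_col !mulmx0 !mulmx1 !addr0.
  by rewrite scale_col_mx scaler0 scalemx1.
have TZ : T *m Z = E *m tau + Z *m T'.
  rewrite TE mul_block_col !mul_col_mx !mulmx0 !mulmx1 !mul1mx !mul0mx.
  by rewrite add_col_mx !add0r addr0.
have gR : g^* = g by rewrite /g -{2}Gh !mxE.
have EWE : qform (lyap G T) E = (t + t^*) * g.
  have LX : T *m E = E *m t%:M by rewrite mul_mx_scalar.
  rewrite /qform (lyap_intertwine _ LX) gE.
  rewrite /lyap adjmx_scalar -!scalar_mxM !mxE eqxx !mulr1n.
  ring.
have t2 : t + t^* < 0.
  have := Tneg 0; rewrite -/t ReE pmulr_llt0 // invr_gt0 ltr0n //.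
have g0 : g <= 0.
  have /psdP[_ /(_ E)] := psdW; rewrite EWE nmulr_rge0 //.
have [w gw] : exists w, g *: w = gam.
  have [gz|gn] := eqVneq g 0; last first.
    by exists (g^-1 *: gam); rewrite scalerA divff ?scale1r.
  have WE : lyap G T *m E = 0.
    by apply: psd_qform_eq0 psdW _; rewrite EWE gz mulr0.
  have EW : E ^t* *m lyap G T = 0.
    by rewrite -[lyap G T]adj_lyap // -adjmxM WE trmx0 map_mx0.
  suff gam0 : gam = 0 by exists 0; rewrite scaler0.
  have : gam *m (T' + (t^*)%:M) = 0.
    rewrite -[RHS](mul0mx _ Z) -EW /lyap mulmxDr mulmxDl mulmxA -!mulmxA TZ.
    rewrite !mulmxDr.
    rewrite !mulmxA gE gz raddf0 !mul0mx add0r.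
    rewrite -/gam -!adjmxM TEE adjmxZ -!scalemxAl -/gam mul_mx_scalar.
    by [].
  rewrite -[RHS](mul0mx _ (T' + (t^*)%:M)); apply: (can_inj (mulmxK _)).
  rewrite -unitmx_tr unitmxE det_trig ?linearD /= ?tr_scalar_mx.
    rewrite unitfE; apply/prodf_neq0 => i _.
    rewrite (_ : _ i i = T' i i + t^*); last by rewrite !mxE eqxx mulr1n.
    have : 'Re (T' i i + t^*) < 0.
      rewrite raddfD /= Re_conj.
      by rewrite -[ltRHS]addr0 ltrD ?T'neg ?(Tneg 0).
    by apply: contraTneq => ->; rewrite raddf0 ltxx.
  apply/is_trig_mxP => i j ij; rewrite !mxE.
  move/is_trig_mxP: T'trig => /(_ _ _ ij); rewrite !mxE => ->.
  by rewrite add0r -val_eqE /= (ltn_eqF ij).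
pose Y : 'M[C]_(n, k) := Z - E *m w.
have EGY : E ^t* *m G *m Y = 0.
  rewrite /Y mulmxBr -/gam mulmxA gE mul_scalar_mx gw subrr //.
have YGE : Y ^t* *m G *m E = 0.
  have <- : (E ^t* *m G *m Y) ^t* = 0 by rewrite EGY trmx0 map_mx0.
  by rewrite !adjmxM trmxCK Gh mulmxA.
have [r TY] : exists r, T *m Y = Y *m T' + E *m r.
  exists (tau - t *: w + w *m T').
  rewrite /Y mulmxBr TZ mulmxA TEE mulmxBl !mulmxDr mulmxN.
  rewrite -scalemxAl -scalemxAr mulmxA [E *m tau - _]addrC addrCA.
  by rewrite subrK [LHS]addrC addrA.
have psdG' : psd (- (Y ^t* *m G *m Y)).
  apply: IHk T'trig T'neg _ _; first exact: adj_sandwich.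
  have -> : lyap (Y ^t* *m G *m Y) T' = Y ^t* *m lyap G T *m Y.
    rewrite /lyap mulmxDr mulmxDl; congr (_ + _).
      by rewrite -!mulmxA TY !mulmxDr !mulmxA YGE !mul0mx addr0.
    have YT : Y ^t* *m T ^t* = T' ^t* *m Y ^t* + r ^t* *m E ^t*.
      by rewrite -adjmxM TY adjmxD !adjmxM.
    rewrite !mulmxA YT !mulmxDl -!mulmxA [E ^t* *m _]mulmxA EGY.
    by rewrite mulmx0 addr0.
  exact: psd_sandwich.
apply/psdP; split; first by rewrite adjmxN Gh.
move=> x; pose z := dsubmx x; pose u := usubmx x + w *m z.
have -> : x = E *m u + Y *m z.
  rewrite /Y /u mulmxBl mulmxDr mulmxA -[LHS]vsubmxK.
  rewrite [Z *m z - _]addrC addrA addrK !mul_col_mx !mul1mx !mul0mx.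
  by rewrite add_col_mx add0r addr0.
have -> : qform (- G) (E *m u + Y *m z)
    = - g * (u ^t* *m u) 0 0 + qform (- (Y ^t* *m G *m Y)) z.
  rewrite !qformN qformD_orthogonal; last 2 first.
  - rewrite adjmxM -!mulmxA [E ^t* *m _]mulmxA [_ *m (Y *m _)]mulmxA EGY.
    by rewrite !(mul0mx, mulmx0).
  - rewrite adjmxM -!mulmxA [Y ^t* *m _]mulmxA [_ *m (E *m _)]mulmxA YGE.
    by rewrite !(mul0mx, mulmx0).
  rewrite -!qform_sandwich gE opprD mulNr; congr (- _ + _).
  by rewrite /qform mul_mx_scalar -scalemxAl mxE.
have /psdP[_ G'0] := psdG'; rewrite addr_ge0 // mulr_ge0 ?oppr_ge0 //.
have [->|u0] := eqVneq u 0; first by rewrite mulmx0 mxE.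
exact/ltW/norm_cvec_gt0.
Qed.

Lemma row_free_vanishing (F : fieldType) k n (Y : 'M[F]_(k, n)) (P : {pred 'I_n}) :
  row_free Y -> (#|P| < k)%N ->
  exists2 z : 'rV_k, z *m Y != 0 & forall i, i \in P -> (z *m Y) 0 i = 0.
Proof.
move=> Yfree Pk; pose M := colsub (enum_val (A := P)) Y.
have : kermx M != 0.
  rewrite -mxrank_eq0 mxrank_ker -lt0n subn_gt0.
  exact: leq_ltn_trans (rank_leq_col _) Pk.
move=> /rowV0Pn[z /sub_kermxP zM z0]; exists z.
  by rewrite mulmx_free_eq0.
move=> i iP; move/rowP: zM => /(_ (enum_rank_in iP i)); rewrite !mxE => zM.
rewrite -[RHS]zM; apply: eq_bigr => j _.
by rewrite mxE enum_rankK_in.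
Qed.

Lemma psd_rank_le n k (h : 'rV[C]_n) (Y : 'M[C]_(k, n)) :
  row_free Y -> (forall i, h 0 i \is Num.real) ->
  psd (- ((Y^T) ^t* *m diag_mx h *m Y^T)) ->
  (k <= #|[pred i | (h 0 i <= 0)%R]|)%N.
Proof.
move=> Yfree hR /psdP[_ G0]; rewrite leqNgt; apply/negP.
move=> /(row_free_vanishing Yfree)[z zY zP].
have := G0 z^T; rewrite qformN qform_sandwich -trmx_mul oppr_ge0 qform_diag.
have terms_ge0 i : 0 <= h 0 i * `|(z *m Y)^T i 0| ^+ 2.
  have [hi|hi] := real_leP (hR i) (real0 C); last first.
    by rewrite mulr_ge0 ?exprn_ge0 // ltW.
  by rewrite mxE zP // normr0 expr0n mulr0.
move=> sum_le0.
have {sum_le0}sum_eq0 : \sum_i h 0 i * `|(z *m Y)^T i 0| ^+ 2 = 0.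
  by apply/eqP; rewrite eq_le sum_le0 sumr_ge0.
case/negP: zY; apply/eqP/rowP => i; rewrite [RHS]mxE.
have [hi|hi] := real_leP (hR i) (real0 C); first exact: zP.
have /eqP := psumr_eq0P (fun j _ => terms_ge0 j) sum_eq0 (i := i) isT.
by rewrite mulf_eq0 gt_eqF //= sqrf_eq0 normr_eq0 mxE => /eqP.
Qed.

Lemma adj_Emx nu n : (Emx C nu n) ^t* = Emx C nu n.
Proof.
rewrite tr_diag_mx map_diag_mx; congr diag_mx; apply/rowP => i; rewrite !mxE.
by case: ifP => _; rewrite ?rmorphN rmorph1.
Qed.

Lemma card_ord_lt nu n : (nu <= n)%N -> #|[pred i : 'I_n | (i < nu)%N]| = nu.
Proof.
move=> nun; rewrite -sum1_card /=.
by rewrite -(big_ord_widen_cond n xpredT (fun=> 1%N) nun) sum1_card card_ord.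
Qed.

Lemma card_ord_ge nu n : (nu <= n)%N -> #|[pred i : 'I_n | (nu <= i)%N]| = (n - nu)%N.
Proof.
move=> nun; have := cardC [pred i : 'I_n | (i < nu)%N].
rewrite card_ord_lt // card_ord => /(canRL (addKn _)) <-.
by apply: eq_card => i; rewrite !inE -leqNgt.
Qed.

Lemma num_eigenvalues_signature n (h : 'rV[C]_n) (L : 'M[C]_n) :
  (forall i, h 0 i \is Num.real) -> (diag_mx h)^t* = diag_mx h ->
  psd (lyap (diag_mx h) L) ->
  (num_eigenvalues (@open_left C) L <= #|[pred i | (h 0 i <= 0)%R]|)%N /\
  (num_eigenvalues (@open_right C) L <= #|[pred i | (0 <= h 0 i)%R]|)%N.
Proof.
move=> hR hh psdL; split.
  have [k [T [Y [kE Yfree YL Ttrig UT]]]] := invariant_subspace (@open_left C) L^T.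
  rewrite -num_eigenvalues_tr -kE; apply: (psd_rank_le Yfree hR).
  have LY : L *m Y^T = Y^T *m T^T by rewrite -[L]trmxK -!trmx_mul YL.
  apply: (@lyap_stable_npsd _ T^T).
  - by rewrite trmxK.
  - by move=> i; rewrite mxE; apply: UT.
  - exact: adj_sandwich.
  - by rewrite -(lyap_intertwine _ LY); apply: psd_sandwich.
have [k [T [Y [kE Yfree YL Ttrig UT]]]] := invariant_subspace (@open_right C) L^T.
rewrite -num_eigenvalues_tr -kE.
apply: leq_trans (psd_rank_le (h := - h) Yfree _ _) _.
- by move=> i; rewrite mxE realN.
- rewrite linearN mulmxN mulNmx opprK.
  have LY : L *m Y^T = Y^T *m T^T by rewrite -[L]trmxK -!trmx_mul YL.
  rewrite -[X in psd X]opprK; apply: (@lyap_stable_npsd _ (- T^T)).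
  - rewrite linearN /= trmxK; apply/is_trig_mxP => i j ij; rewrite mxE.
    by move/is_trig_mxP: Ttrig => ->; rewrite // oppr0.
  - by move=> i; rewrite !mxE raddfN oppr_lt0; apply: UT.
  - by rewrite adjmxN adj_sandwich.
  - rewrite /lyap adjmxN !mulNmx !mulmxN !opprK.
    rewrite -[X in psd X]/(lyap _ _) -(lyap_intertwine _ LY); exact: psd_sandwich.
- by apply: subset_leq_card; apply/fintype.subsetP => i; rewrite !inE mxE oppr_le0.
Qed.

Lemma num_eigenvalues_Lbar_Emx nu n (L : 'M[C]_n) : (nu <= n)%N ->
  Lbar (Emx C nu n) L ->
  (num_eigenvalues (@open_left C) L <= nu)%N /\
  (num_eigenvalues (@open_right C) L <= n - nu)%N.
Proof.
move=> nun; rewrite LbarE => psdL.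
pose h : 'rV[C]_n := \row_(i < n) (if (i < nu)%N then -1 else 1).
have hR i : h 0 i \is Num.real by rewrite mxE; case: ifP; rewrite ?realN real1.
have [lt gt] := num_eigenvalues_signature hR (adj_Emx nu n) psdL.
rewrite -[X in (_ <= X)%N /\ _](card_ord_lt nun) -(card_ord_ge nun).
split; [apply: leq_trans lt _|apply: leq_trans gt _];
  apply: subset_leq_card; apply/fintype.subsetP => i; rewrite !inE mxE.
  by case: ltnP; rewrite // ler10.
by case: ltnP; rewrite // oppr_ge0 ler10.
Qed.
End Inertia.

(** * Maximality *)

Section Maximality.
Variable C : numClosedFieldType.

Local Notation sgn nu i := (if (i < nu)%N then -1 else 1 : C).

Lemma Emx_sqr nu n : Emx C nu n *m Emx C nu n = 1%:M.
Proof.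
rewrite mulmx_diag -diag_const_mx; congr diag_mx; apply/rowP => i; rewrite !mxE.
by case: ifP; rewrite ?mulrNN mulr1.
Qed.

Lemma qformZr n (P : 'M[C]_n) (c : C) x : qform P (c *: x) = `|c| ^+ 2 * qform P x.
Proof.
rewrite /qform adjmxZ -!scalemxAl -scalemxAr scalerA mxE normCK; congr (_ * _).
exact: mulrC.
Qed.

Lemma qform_delta n (P : 'M[C]_n) j : qform P (delta_mx j 0) = P j j.
Proof.
rewrite /qform -mulmxA -colE.
rewrite (_ : (delta_mx j 0)^t* = delta_mx 0 j); last first.
  by rewrite trmx_delta map_delta_mx.
by rewrite -rowE !mxE.
Qed.

Lemma qform_isReal n (P : 'M[C]_n) x : P ^t* = P -> qform P x \is Num.real.
Proof. by move=> Ph; apply/CrealP/qform_real. Qed.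

Lemma phase_le0 (z : C) : exists2 u : C, `|u| = 1 & u * z <= 0.
Proof.
have [->|z0] := eqVneq z 0; first by exists 1; rewrite ?normr1 ?mulr0.
have nz : `|z| != 0 by rewrite normr_eq0.
exists (- z^* / `|z|).
  by rewrite normrM normrN norm_conjC normfV normr_id divff.
by rewrite mulrAC mulNr [_^* * _]mulrC -normCK expr2 mulNr mulfK // oppr_le0.
Qed.

(* [R] is the [H]-orthogonal reflection in the hyperplane [H]-orthogonal to     *)
(* [e_j - y]; it swaps [e_j] and [y].                                           *)
Lemma Emx_reflection nu n (j : 'I_n) (y : 'cV[C]_n) :
  qform (Emx C nu n) y = sgn nu j -> y j 0 <= 0 ->
  exists R : 'M[C]_n, [/\ R *m R = 1%:M, R ^t* *m Emx C nu n = Emx C nu n *m R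
    & R *m delta_mx j 0 = y].
Proof.
set H := Emx C nu n; set s := sgn nu j => Hy yj.
pose e : 'cV[C]_n := delta_mx j 0; pose w := e - y.
have Hh : H ^t* = H := adj_Emx C nu n.
have s2 : s * s = 1 by rewrite /s; case: ifP; rewrite ?mulrNN mulr1.
have s0 : s != 0 by apply/eqP => sz; move/eqP: s2; rewrite sz mul0r eq_sym oner_eq0.
have yR : (y j 0)^* = y j 0 by apply/CrealP/ler0_real.
have eH : e ^t* *m H = s *: e ^t*.
  rewrite /e trmx_delta map_delta_mx /H /Emx mul_mx_diag.
  apply/rowP => i; rewrite !mxE eqxx /=.
  by case: (i =P j) => [->|_]; rewrite ?mulr0 ?mul0r // mulr1 mul1r.
have He : H *m e = s *: e.
  have <- : (e ^t* *m H) ^t* = H *m e by rewrite adjmxM trmxCK Hh.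
  rewrite eH adjmxZ trmxCK; congr (_ *: _).
  by rewrite /s; case: ifP; rewrite ?rmorphN rmorph1.
have ye : (y ^t* *m e) = (y j 0)%:M.
  by rewrite -colE [LHS]mx11_scalar !mxE yR.
have wHe : w ^t* *m H *m e = (s * (1 - y j 0))%:M.
  rewrite -mulmxA He -scalemxAr adjmxD adjmxN mulmxDl mulNmx ye.
  have -> : e ^t* *m e = 1%:M.
    by rewrite /e trmx_delta map_delta_mx mul_delta_mx [LHS]mx11_scalar mxE.
  by rewrite -raddfB /= scale_scalar_mx.
have ey : e ^t* *m y = (y j 0)%:M.
  by rewrite /e trmx_delta map_delta_mx -rowE [LHS]mx11_scalar mxE.
pose k := s * (1 - y j 0) * 2.
have wHw : w ^t* *m H *m w = k%:M.
  rewrite {2}/w mulmxBr wHe adjmxD adjmxN !mulmxDl !mulNmx.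
  rewrite eH -scalemxAl ey scale_scalar_mx.
  rewrite [y ^t* *m H *m y]mx11_scalar -[(_ *m y) 0 0]/(qform H y) Hy.
  by rewrite -!raddfB /=; congr (_%:M); rewrite /k; ring.
have k0 : k != 0.
  rewrite /k !mulf_neq0 ?pnatr_eq0 //; apply/lt0r_neq0.
  by rewrite subr_gt0 (le_lt_trans yj).
pose a := 2 / k.
have aR : a^* = a.
  rewrite /a /k fmorph_div !rmorphM rmorphB rmorph_nat rmorph1 /= yR.
  by rewrite /s; case: ifP; rewrite ?rmorphN rmorph1.
exists (1%:M - a *: (w *m w ^t* *m H)); split.
- set N := w *m w ^t* *m H.
  have NN : N *m N = k *: N.
    rewrite /N !mulmxA -[w *m _ *m H]mulmxA -[w *m _ *m w]mulmxA wHw.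
    by rewrite mul_mx_scalar -!scalemxAl !mulmxA.
  rewrite mulmxBl mul1mx mulmxBr mulmx1 -scalemxAl -scalemxAr NN.
  rewrite [a *: (k *: _)]scalerA /a mulfVK // scaler_nat mulr2n -/a scalerDr.
  by rewrite opprB addrK subrK.
- rewrite adjmxD adjmxN adjmxZ aR !adjmxM trmxCK Hh adjmx_scalar conjC1.
  by rewrite mulmxBl mulmxBr mul1mx mulmx1 -scalemxAl -scalemxAr !mulmxA.
- rewrite mulmxBl mul1mx -scalemxAl -!mulmxA [w ^t* *m _]mulmxA wHe.
  rewrite mul_mx_scalar scalerA.
  have -> : a * (s * (1 - y j 0)) = 1.
    by rewrite /a mulrAC -[2 * _]mulrC -/k divff.
  by rewrite scale1r /w opprB addrC subrK.
Qed.

Lemma not_psd_negative_vector nu n (Q : 'M[C]_n) :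
  Q ^t* = Q -> ~ psd Q ->
  exists2 x, qform Q x < 0 & qform (Emx C nu n) x != 0.
Proof.
move=> Qh Qn; set H := Emx C nu n; have Hh : H ^t* = H := adj_Emx C nu n.
have [x xQ] : exists x, qform Q x < 0.
  apply: contrapT => noQ; apply: Qn; apply/psdP; split=> // x.
  have [//|Qx] := real_leP (real0 C) (qform_isReal x Qh).
  by case: noQ; exists x.
have [Hx|] := eqVneq (qform H x) 0; last by exists x.
set q := qform Q x in xQ.
pose A := (x ^t* *m Q *m (H *m x)) 0 0 + ((H *m x) ^t* *m Q *m x) 0 0.
pose B := qform Q (H *m x).
pose d := - q / (`|A| + `|B| - q).
have q0 : 0 < - q by rewrite oppr_gt0.
have den0 : 0 < `|A| + `|B| - q by rewrite ltr_wpDl // addr_ge0.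
have d0 : 0 < d by rewrite divr_gt0.
have d1 : d <= 1 by rewrite ler_pdivrMr // mul1r lerDr addr_ge0.
have dR : d^* = d by apply/CrealP/ger0_real/ltW.
have expand (P : 'M[C]_n) : qform P (x + d *: (H *m x)) =
    qform P x + d * ((x ^t* *m P *m (H *m x)) 0 0 + ((H *m x) ^t* *m P *m x) 0 0)
    + d ^+ 2 * qform P (H *m x).
  rewrite /qform adjmxD adjmxZ dR !mulmxDl !mulmxDr -!scalemxAl -!scalemxAr.
  move: (x ^t* *m P *m x) (x ^t* *m P *m (H *m x)) ((H *m x) ^t* *m P *m x).
  move: ((H *m x) ^t* *m P *m (H *m x)) => m1 m2 m3 m4.
  by rewrite !mxE; ring.
have x0 : x != 0.
  by apply: contraTneq xQ => xz; rewrite /q xz /qform mulmx0 mxE ltxx.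
exists (x + d *: (H *m x)); rewrite expand.
  rewrite -/q -/A -/B.
  have AR : A \is Num.real.
    pose a := x ^t* *m Q *m (H *m x).
    have -> : A = a 0 0 + (a 0 0)^*.
      by rewrite -adjmx11 /A /a !adjmxM trmxCK Qh !mulmxA.
    by apply/CrealP; rewrite rmorphD /= conjCK addrC.
  have BR : B \is Num.real by apply: qform_isReal.
  have dA : d * A <= d * `|A| by rewrite ler_pM2l // real_ler_norm.
  have dB : d ^+ 2 * B <= d * `|B|.
    apply: le_trans (_ : d ^+ 2 * `|B| <= _).
      by rewrite ler_pM2l ?exprn_gt0 // real_ler_norm.
    by rewrite ler_wpM2r // expr2 ler_piMr // ltW.
  apply: le_lt_trans (_ : q + d * `|A| + d * `|B| < 0).
    by rewrite lerD // lerD.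
  rewrite -addrA -mulrDr addrC -[q in _ + q]opprK subr_lt0.
  rewrite /d mulrAC ltr_pdivrMr // ltr_pM2l //.
  by rewrite ltrDl.
have HH := Emx_sqr nu n; rewrite -/H in HH.
have -> : qform H (H *m x) = 0.
  by rewrite /qform adjmxM Hh !mulmxA -[_ *m H *m H]mulmxA HH mulmx1.
rewrite Hx add0r mulr0 addr0 adjmxM Hh !mulmxA -[_ *m H *m H]mulmxA HH mulmx1.
rewrite mulf_neq0 ?(gt_eqF d0) // -mulr2n mulrn_eq0 /=.
by rewrite gt_eqF ?norm_cvec_gt0.
Qed.
End Maximality.

Section LbarSet.
Variable C : numClosedFieldType.

Lemma Hmx_Emx nu n p : (nu <= n)%N -> Hmx C nu n p = Emx C nu (n + p).
Proof.
move=> nun; rewrite /Hmx /Emx -(diag_const_mx p 1) -diag_mx_row; congr diag_mx.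
apply/rowP => i; rewrite [RHS]mxE; case: (split_ordP i) => j ->.
  by rewrite row_mxEl mxE.
by rewrite row_mxEr mxE /= ltnNge (leq_trans nun) // leq_addr.
Qed.

Lemma lyapD n (H L M : 'M[C]_n) : lyap H (L + M) = lyap H L + lyap H M.
Proof. by rewrite /lyap adjmxD mulmxDl mulmxDr addrACA. Qed.

Lemma lyapZ n (H L : 'M[C]_n) a : a^* = a -> lyap H (a *: L) = a *: lyap H L.
Proof.
by move=> aR; rewrite /lyap adjmxZ aR -scalemxAr -scalemxAl -scalerDr.
Qed.

Lemma Lbar_cone n (H : 'M[C]_n) : H ^t* = H -> convex_invertible_cone (Lbar H).
Proof.
move=> Hh; split=> [a L a0|L M|L]; rewrite !LbarE.
- rewrite lyapZ; last exact/CrealP/ger0_real/ltW.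
  by apply: psd_scale; apply: ltW.
- by move=> psdL psdM; rewrite lyapD; apply: psd_add.
- move=> psdL Lu; have := psd_sandwich (invmx L) psdL; rewrite /lyap mulmxDr mulmxDl.
  rewrite mulmxA -(mulmxA _ L) mulmxV // mulmx1 mulmxA -adjmxM mulmxV //.
  by rewrite adjmx_scalar conjC1 mul1mx addrC.
Qed.

Lemma Lbar_block_ul n p (E : 'M[C]_n) (F : 'M[C]_p) (L : 'M[C]_(n + p)) :
  Lbar (block_mx E 0 0 F) L -> Lbar E (ulsubmx L).
Proof.
rewrite !LbarE => /(psd_sandwich (col_mx 1%:M 0 : 'M[C]_(n + p, n))).
congr psd; rewrite /lyap -{1 2}(submxK L) adj_block_mx !mulmx_block add_block_mx.
rewrite adj_col_mx adjmx_scalar conjC1 mul_row_block mul_row_col.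
by rewrite !(mul0mx, mulmx0, mul1mx, mulmx1, trmx0, map_mx0, addr0).
Qed.

Lemma normalized_vector n (H Q : 'M[C]_n) x (s : C) (j : 'I_n) :
  0 < s * qform H x -> s * s = 1 -> qform Q x < 0 ->
  exists y, [/\ qform H y = s, y j 0 <= 0 & qform Q y < 0].
Proof.
set m := s * _ => m0 s2 xQ; have [u u1 ux] := phase_le0 (x j 0).
pose c := (sqrtC m)^-1.
have c0 : 0 < c by rewrite invr_gt0 sqrtC_gt0.
have cn : `|c * u| ^+ 2 = m^-1.
  by rewrite normrM u1 mulr1 (gtr0_norm c0) exprVn sqrtCK.
exists ((c * u) *: x); rewrite !qformZr cn; split.
- have -> : qform H x = s * m by rewrite /m mulrA s2 mul1r.
  by rewrite mulrCA mulVf ?mulr1 // gt_eqF.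
- by rewrite mxE -mulrA pmulr_rle0.
- by rewrite pmulr_rlt0 // invr_gt0.
Qed.

Lemma Emx_qform_ge0 n x : 0 <= qform (Emx C 0 n) x.
Proof.
by rewrite qform_diag sumr_ge0 // => i _; rewrite mxE mul1r exprn_ge0.
Qed.

(* A triangular [Z] with prescribed Hermitian part off the diagonal leaves the  *)
(* diagonal, hence the spectrum of [H Z], free.                                 *)
Lemma triangular_completion nu n (M R : 'M[C]_n) (j : 'I_n) :
  R *m R = 1%:M -> R ^t* *m Emx C nu n = Emx C nu n *m R ->
  qform (lyap (Emx C nu n) M) (R *m delta_mx j 0) < 0 ->
  exists2 L, Lbar (Emx C nu n) L & exists2 z : 'I_n -> C,
    (forall i, if i == j then z i < 0 else 0 < z i) &
    forall U, num_eigenvalues U (L + M) =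
      #|[pred i : 'I_n | U ((if (i < nu)%N then -1 else 1) * z i)]|.
Proof.
set H := Emx C nu n => RR RH Qneg; have Hh : H ^t* = H := adj_Emx C nu n.
have [Q QE] : exists Q, Q = R ^t* *m lyap H M *m R by eexists.
have Qh : Q ^t* = Q by rewrite QE; apply/adj_sandwich/adj_lyap.
have QR i k : (Q i k)^* = Q k i by rewrite -[in RHS]Qh !mxE.
have Qii i : Q i i \is Num.real by apply/CrealP.
pose z i := if i == j then Q i i / 2 else `|Q i i| + 1.
pose Z : 'M[C]_n := \matrix_(i, k)
  if i == k then z i else if (k < i)%N then Q i k else 0.
have zR i : z i \is Num.real.
  by rewrite /z; case: eqP => _;
    rewrite ?rpredM ?rpredV ?rpredD ?normr_real ?realn ?real1.
pose T := R *m (H *m Z) *m R.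
have TR : T *m R = R *m (H *m Z) by rewrite -mulmxA RR mulmx1.
have RHR : R ^t* *m H *m R = H by rewrite RH -mulmxA RR mulmx1.
exists (T - M).
  rewrite LbarE.
  have RRh : R ^t* *m R ^t* = 1%:M by rewrite -adjmxM RR adjmx_scalar conjC1.
  have -> : lyap H (T - M) = R ^t* *m (R ^t* *m lyap H (T - M) *m R) *m R.
    by rewrite !mulmxA RRh mul1mx -mulmxA RR mulmx1.
  apply: psd_sandwich; rewrite -scaleN1r lyapD lyapZ ?rmorphN ?rmorph1 //.
  rewrite scaleN1r mulmxBr mulmxBl -QE (lyap_intertwine _ TR) RHR.
  have -> : lyap H (H *m Z) - Q = diag_mx (\row_i (z i *+ 2 - Q i i)).
    rewrite /lyap adjmxM Hh mulmxA -[_ *m H *m H]mulmxA Emx_sqr mul1mx mulmx1.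
    apply/matrixP => i k; rewrite !mxE eq_sym.
    have [<-|ik] := eqVneq i k.
      by rewrite (CrealP (zR i)) mulr1n mulr2n.
    rewrite mulr0n; have [ki|ik'|/val_inj/eqP] := ltngtP k i.
    - by rewrite rmorph0 addr0 subrr.
    - by rewrite QR add0r subrr.
    - by rewrite eq_sym (negPf ik).
  apply/psdP; split.
    rewrite tr_diag_mx map_diag_mx; congr diag_mx; apply/rowP => i; rewrite !mxE.
    by apply/CrealP; rewrite rpredB ?rpredMn.
  move=> x; rewrite qform_diag sumr_ge0 // => i _; rewrite mulr_ge0 ?exprn_ge0 //.
  rewrite mxE /z; case: eqP => _.
    by rewrite -mulr_natr divfK ?pnatr_eq0 // subrr.
  rewrite subr_ge0 mulr2n (le_trans (real_ler_norm (Qii i))) //.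
  by rewrite -addrA lerDl addr_ge0 ?addr_ge0.
exists z.
  move=> i; rewrite /z; case: eqP => [->|_].
    by rewrite pmulr_llt0 ?invr_gt0 ?ltr0n // -qform_delta QE qform_sandwich.
  by rewrite ltr_wpDl.
move=> U; rewrite subrK.
have Ru : R \in unitmx by case: (mulmx1_unit RR).
have RT : R *m T = H *m Z *m R by rewrite /T !mulmxA RR mul1mx.
rewrite /num_eigenvalues (char_poly_intertwine Ru RT).
rewrite -[count _ _]/(num_eigenvalues U (H *m Z)) num_eigenvalues_trig.
  by apply: eq_card => i; rewrite !inE mul_diag_mx !mxE eqxx.
apply/is_trig_mxP => i k ik; rewrite mul_diag_mx !mxE -val_eqE /= (ltn_eqF ik).
by rewrite [(k < i)%N]ltnNge (ltnW ik) mulr0.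
Qed.

Lemma card_predU1 n (P : pred 'I_n) (j : 'I_n) : ~~ P j ->
  #|[pred i | P i || (i == j)]| = #|P|.+1.
Proof.
move=> Pj; have := cardU1 j P; rewrite [j \notin P]Pj add1n => <-.
by apply: eq_card => i; rewrite !inE orbC.
Qed.

Lemma Lbar_maximal nu n (M : 'M[C]_n) : (nu < n)%N ->
  ~ Lbar (Emx C nu n) M ->
  exists2 L, Lbar (Emx C nu n) L &
    num_eigenvalues (@open_left C) (L + M) = nu.+1 \/
    num_eigenvalues (@open_right C) (L + M) = (n - nu).+1.
Proof.
move=> nun; rewrite LbarE => Mn; have Hh := adj_Emx C nu n.
have [x xQ xH] := not_psd_negative_vector nu (adj_lyap M Hh) Mn.
pose e i : C := if (i < nu)%N then -1 else 1.
have e2 i : e i * e i = 1 by rewrite /e; case: ifP; rewrite ?mulrNN mulr1.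
have [j jx] : exists j : 'I_n, 0 < e j * qform (Emx C nu n) x.
  have [Hx|Hx] := real_ltP (real0 C) (qform_isReal x Hh).
    by exists (Ordinal nun); rewrite /e ltnn mul1r.
  have {xH Hx}Hx : qform (Emx C nu n) x < 0 by rewrite lt_def eq_sym xH.
  case: nu nun {Mn xQ Hh e2} @e Hx => [|nu] nun e Hx.
    by rewrite (le_gtF (Emx_qform_ge0 x)) in Hx.
  by exists (Ordinal (leq_ltn_trans (leq0n _) nun)); rewrite /e mulN1r oppr_gt0.
have [y [yH yj yQ]] := normalized_vector j jx (e2 j) xQ.
have [R [RR RH Re]] := Emx_reflection yH yj.
rewrite -Re in yQ; have [L psdL [z zP eigL]] := triangular_completion RR RH yQ.
exists L => //; rewrite !eigL.
have zR (i : 'I_n) : e i * z i \is Num.real.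
  have zi : z i \is Num.real.
    by have := zP i; case: eqP => _; [apply: ltr0_real | apply: gtr0_real].
  by rewrite rpredM // /e; case: ifP; rewrite ?rpredN real1.
have [nuj|jnu] := leqP nu j; [left|right].
  rewrite -[in RHS](card_ord_lt (ltnW nun)).
  rewrite -(card_predU1 (j := j)) -?leqNgt //.
  apply: eq_card => i; rewrite !inE /open_left (Creal_ReP _ (zR i)) /e.
  have := zP i; case: (i =P j) => [->|_] zi.
    by rewrite ltnNge nuj mul1r zi orbT.
  by case: ifP => _; rewrite ?mulN1r ?mul1r ?oppr_lt0 ?zi // lt_gtF.
rewrite -[in RHS](card_ord_ge (ltnW nun)) -(card_predU1 (j := j)) -?ltnNge //.
apply: eq_card => i; rewrite !inE /open_right (Creal_ReP _ (zR i)) /e.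
have := zP i; case: (i =P j) => [->|_] zi.
  by rewrite jnu mulN1r oppr_gt0 zi orbT.
by case: ltnP => _; rewrite ?mulN1r ?mul1r ?oppr_gt0 ?zi // lt_gtF.
Qed.
End LbarSet.

(** * Closedness *)

Section Topology.
Variable C : numClosedFieldType.

Lemma open_Re_lt0 : open [set z : C | 'Re z < 0].
Proof.
rewrite openE => z /= z0; apply/nbhs_ballP; exists (- 'Re z).
  by rewrite /= oppr_gt0.
move=> w; rewrite -ball_normE /= => zw.
have -> : w = z + (w - z) by rewrite addrC subrK.
rewrite raddfD /= -ltrBrDl sub0r (le_lt_trans _ zw) // distrC.
exact: le_trans (real_ler_norm (Creal_Re _)) (leif_normC_Re_Creal _).1.
Qed.

Lemma continuous_entry_mul m n k l (A : 'M[C]_(k, m)) (B : 'M[C]_(n, l)) i j :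
  continuous (fun L : 'M[C]_(m, n) => (A *m L *m B) i j).
Proof.
have -> : (fun L : 'M[C]_(m, n) => (A *m L *m B) i j)
    = (fun L => \sum_b \sum_a A i a * L a b * B b j).
  by apply/funext => L; rewrite mxE; apply: eq_bigr => b _; rewrite mxE mulr_suml.
move=> L; apply: (@cvg_big _ _ _ _ _ add_continuous _ (nbhs L)) => b _.
apply: (@cvg_big _ _ _ _ _ add_continuous _ (nbhs L)) => a _.
apply: cvgM; last exact: cvg_cst.
by apply: cvgM; [exact: cvg_cst | exact: coord_continuous].
Qed.

Lemma closed_Lbar n (H : 'M[C]_n) : H ^t* = H -> closed (Lbar H).
Proof.
move=> Hh.
have -> : Lbar H = \bigcap_(x in [set: 'cV[C]_n])
    ((fun L => (x ^t* *m H *m L *m x) 0 0) @^-1` (~` [set z : C | 'Re z < 0])).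
  have lyapE L x : qform (lyap H L) x = 2 * 'Re ((x ^t* *m H *m L *m x) 0 0).
    rewrite /lyap qformD ReE mulrC divfK ?pnatr_eq0 // /qform -adjmx11.
    by rewrite !adjmxM trmxCK Hh !mulmxA.
  apply/seteqP; split=> L /=.
    move=> /psdP[_ L0] x _ /=; apply/negP; rewrite -real_leNgt ?Creal_Re ?real0 //.
    by have := L0 x; rewrite lyapE pmulr_rge0.
  move=> L0; apply/psdP; split=> [|x]; first exact: adj_lyap.
  have /negP := L0 x I; rewrite -real_leNgt ?Creal_Re ?real0 // lyapE.
  by move=> ?; rewrite mulr_ge0.
apply: closed_bigI => x _; apply: closed_comp.
  by move=> L _; exact: continuous_entry_mul.
exact/open_closedC/open_Re_lt0.
Qed.
End Topology.

Theorem theorem7p3 (R : realType) (r p nu : nat) :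
  (2 <= r)%N -> (1 <= p <= r - 1)%N -> (nu <= r - p)%N ->
  let S : set 'M[complexC R]_((r - p) + p) := Lbar (Hmx (complexC R) nu (r - p) p) in
  [/\ closed S,
      convex_invertible_cone S,
      forall L, S L ->
        (num_poles (@open_left (complexC R)) (transfer L) <= nu)%N /\
        (num_poles (@open_right (complexC R)) (transfer L) <= r - p - nu)%N,
      forall L, S L ->
        (num_eigenvalues (@open_left (complexC R)) L <= nu)%N /\
        (num_eigenvalues (@open_right (complexC R)) L <= r - nu)%N
    & forall (Lt : 'M[complexC R]_((r - p) + p)) (psit : 'M[ratfun (complexC R)]_p),
        psit = transfer Lt -> ~ GP r nu psit ->
        exists2 L, S L &
          num_eigenvalues (@open_left (complexC R)) (L + Lt) = nu.+1 \/
          num_eigenvalues (@open_right (complexC R)) (L + Lt) = (r - nu).+1].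
Proof.
move=> r2 /andP[p1 pr] nur /=; set S := Lbar _.
have rE : (r - p + p)%N = r by rewrite subnK // (leq_trans pr) ?leq_subr.
have SE : S = Lbar (Emx (complexC R) nu (r - p + p)) by rewrite /S Hmx_Emx.
have nulr : (nu <= r - p + p)%N by rewrite (leq_trans nur) ?leq_addr.
split.
- by rewrite SE; apply/closed_Lbar/adj_Emx.
- by rewrite SE; apply/Lbar_cone/adj_Emx.
- move=> L /Lbar_block_ul/(num_eigenvalues_Lbar_Emx nur)[ltA gtA].
  by split; apply: leq_trans (num_poles_le _ _) _.
- move=> L; rewrite SE => /(num_eigenvalues_Lbar_Emx nulr).
  by rewrite [X in (_ <= X - _)%N]rE.
move=> Lt _ -> notGP.
have nun : (nu < r - p + p)%N.
  by apply: leq_ltn_trans nur _; rewrite -[X in (X < _)%N]addn0 ltn_add2l.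
have [|L SL eigL] := @Lbar_maximal _ nu _ Lt nun.
  by rewrite -SE => SLt; apply: notGP; exists Lt.
by exists L; [rewrite SE | rewrite -[X in (X - nu)%N]rE].
Qed.
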